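(* Let $d\ge 1$, $m\ge 2$, and let $\boldsymbol{w}_1,\dots,\boldsymbol{w}_m\in\mathbb{R}^d$ be random vectors (possibly dependent on one another) such that each $\boldsymbol{w}_i$ is marginally distributed as $\mathcal{N}(0,\mathbf{I}_d)$ and, for every $i\neq j$, the distribution of $\boldsymbol{w}_i+\boldsymbol{w}_j$ is rotationally invariant. For $\boldsymbol{x},\boldsymbol{y}\in\mathbb{R}^d$ let $\widehat{K}(\boldsymbol{x},\boldsymbol{y})=\phi(\boldsymbol{x})^\top\phi(\boldsymbol{y})$ be the positive random feature estimator of $K(\boldsymbol{x},\boldsymbol{y})=\exp(-\|\boldsymbol{x}-\boldsymbol{y}\|_2^2/2)$, and write $x=\|\boldsymbol{x}\|_2$, $y=\|\boldsymbol{y}\|_2$, $v=\|\boldsymbol{x}+\boldsymbol{y}\|_2$. Then $$\mathrm{MSE}(\widehat{K})=\mathbb{E}\big[(\widehat{K}(\boldsymbol{x},\boldsymbol{y})-K(\boldsymbol{x},\boldsymbol{y}))^2\big]=\frac{e^{-2x^2-2y^2}}{m}\Big((e^{2v^2}-e^{v^2})+(m-1)\big(\rho(\boldsymbol{x},\boldsymbol{y})-e^{v^2}\big)\Big).$$ In particular, the MSE is an increasing function of the RF-conformity $\rho(\boldsymbol{x},\boldsymbol{y})$.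
   Context: Positive random features (PRFs): given random vectors $\boldsymbol{w}_1,\dots,\boldsymbol{w}_m\in\mathbb{R}^d$, define for $\boldsymbol{z}\in\mathbb{R}^d$ the feature map $\phi(\boldsymbol{z})=\frac{1}{\sqrt m}\exp(-\|\boldsymbol{z}\|_2^2)\big(\exp(\boldsymbol{w}_1^\top\boldsymbol{z}),\dots,\exp(\boldsymbol{w}_m^\top\boldsymbol{z})\big)^\top\in\mathbb{R}^m$. The RF-conformity is $$\rho(\boldsymbol{x},\boldsymbol{y})=\frac{\Gamma(\frac d2)}{m(m-1)}\sum_{i=1}^m\sum_{j\neq i}\mathbb{E}\left(\sum_{k=0}^\infty\frac{v^{2k}w_{ij}^{2k}}{2^{2k}k!\,\Gamma(k+\frac d2)}\right),\qquad w_{ij}=\|\boldsymbol{w}_i+\boldsymbol{w}_j\|_2,\ v=\|\boldsymbol{x}+\boldsymbol{y}\|_2,$$ where $\Gamma$ is the Gamma function. *)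

(* Defs.v *)
From HB Require Import structures.
From mathcomp Require Import all_boot all_order all_algebra.
From mathcomp Require Import all_classical all_reals all_analysis.
From mathcomp Require Import probability.
Set Implicit Arguments. Unset Strict Implicit. Unset Printing Implicit Defensive.
Import Order.TTheory GRing.Theory Num.Theory.
Import numFieldNormedType.Exports.
Local Open Scope classical_set_scope.
Local Open Scope ring_scope.

Section Defs.
Variable R : realType.

Definition dotv d (a b : 'rV[R]_d) : R := \sum_(k < d) a 0 k * b 0 k.
Definition norm2 d (a : 'rV[R]_d) : R := Num.sqrt (\sum_(k < d) a 0 k ^+ 2).

Definition Gamma (s : R) : R :=
  fine (\int[@lebesgue_measure R]_(t in `]0%R, +oo[%classic)
          ((t `^ (s - 1)) * expR (- t))%:E)%E.

Definition gaussK d (x y : 'rV[R]_d) : R := expR (- (norm2 (x - y)) ^+ 2 / 2).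

Context (dT : measure_display) (T : measurableType dT).

Definition prf_phi d m (w : 'I_m -> T -> 'rV[R]_d) (t : T) (z : 'rV[R]_d)
  : 'rV[R]_m :=
  \row_(i < m) ((Num.sqrt (m%:R))^-1 * expR (- (norm2 z) ^+ 2)
                 * expR (dotv (w i t) z)).

Definition Khat d m (w : 'I_m -> T -> 'rV[R]_d) (x y : 'rV[R]_d) (t : T) : R :=
  dotv (prf_phi w t x) (prf_phi w t y).

Variable P : probability T R.

(* X : T -> R^d is distributed as N(0, I_d): its law agrees with the product
   of d standard normal laws on all measurable rectangles (a pi-system
   generating the Borel sets of R^d, so this determines the law). *)
Definition std_gaussian_vec d (X : T -> 'rV[R]_d) : Prop :=
  forall A : 'I_d -> set R, (forall k, measurable (A k)) ->
    P [set t | forall k, A k (X t 0 k)] = (\prod_(k < d) normal_prob 0 1 (A k))%E.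

Definition same_law d (X Y : T -> 'rV[R]_d) : Prop :=
  forall A : 'I_d -> set R, (forall k, measurable (A k)) ->
    P [set t | forall k, A k (X t 0 k)] = P [set t | forall k, A k (Y t 0 k)].

Definition rot_invariant d (X : T -> 'rV[R]_d) : Prop :=
  forall Q : 'M[R]_d, Q *m Q^T = 1%:M -> same_law X (fun t => X t *m Q).

Definition rf_conformity d m (w : 'I_m -> T -> 'rV[R]_d) (x y : 'rV[R]_d)
  : \bar R :=
  let v := norm2 (x + y) in
  ((Gamma (d%:R / 2) / (m%:R * (m%:R - 1)))%:E *
   \sum_(i < m) \sum_(j < m | j != i)
     \int[P]_t (\sum_(0 <= k <oo)
        ((v ^+ (2 * k) * (norm2 (w i t + w j t)) ^+ (2 * k)
          / (2 ^+ (2 * k) * k`!%:R * Gamma (k%:R + d%:R / 2)))%:E)))%E.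

End Defs.

(* Main.v *)
Require Import Defs.
From HB Require Import structures.
From mathcomp Require Import all_boot all_order all_algebra.
From mathcomp Require Import all_classical all_reals all_analysis.
From mathcomp Require Import probability.
From mathcomp Require Import measurable_realfun ring lra.
Import Order.TTheory GRing.Theory Num.Theory.
Import numFieldNormedType.Exports.
Local Open Scope classical_set_scope.
Local Open Scope ring_scope.

(** With z = x + y, the estimator minus the kernel is
    exp(-|x|^2-|y|^2) ((1/m) sum_i exp(w_i.z) - exp(|z|^2/2)); expanding the
    square leaves E exp(w_i.z) and E exp(2 w_i.z), which are Gaussian moment
    generating functions, and E exp(u.z) for u = w_i + w_j, i <> j.
    For a rotation-invariant u, E exp(u.z) = E cosh(u.z) =
    sum_k |z|^(2k) E u_0^(2k) / (2k)!.  Put m(j,k) = E |u|^(2j) u_0^(2k).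
    Rotation invariance gives
      E |u|^(2j) (u_0 + s u_b)^(2k+2) = (1 + s^2)^(k+1) m(j,k+1)  for all s;
    comparing the coefficients of s^2 and summing over b yields
      (2k+1) m(j+1,k) = (2k+d) m(j,k+1),
    which together with Gamma(s+1) = s Gamma(s) expresses E u_0^(2k) through
    E |u|^(2k) and turns the series into the RF-conformity. *)

(** * Extending integral identities from indicators to nonnegative functions *)

Section indicator_extension.
Import HBNNSimple.

(** Linearity carries the indicator identity to nonnegative simple functions, and monotone
    convergence along simple approximations of [h] carries it to the limit. The weight [g] serves
    two uses: as a density with [phi = id], and as the product of the factors that depend on the
    other coordinates. *)
Lemma ge0_integral_indic_ext d d' (T : measurableType d) (Y : measurableType d')
  (R : realType) (mu : {measure set T -> \bar R})
  (nu : {measure set Y -> \bar R})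
  (phi : T -> Y) (g : T -> R) (c : R) :
  measurable_fun setT phi -> measurable_fun setT g ->
  (forall t, 0 <= g t) ->
  (forall A, measurable A ->
    (\int[mu]_t (g t * \1_A (phi t))%:E = c%:E * nu A)%E) ->
  forall h : Y -> R, measurable_fun setT h -> (forall y, 0 <= h y) ->
  (\int[mu]_t (g t * h (phi t))%:E = c%:E * \int[nu]_y (h y)%:E)%E.
Proof.
move=> mphi mg g0 gnu h mh h0.
have mEh : measurable_fun [set: Y] (fun y => (h y)%:E).
  exact/measurable_EFinP.
pose f_ := nnsfun_approx measurableT mEh.
have ndf y : {homo f_ ^~ y : a b / (a <= b)%N >-> a <= b}.
  by move=> a b ab; exact/lefP/nd_nnsfun_approx.
have cvf y : (f_ n y)%:E @[n --> \oo] --> (h y)%:E.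
  by apply: cvg_nnsfun_approx => // ? _; rewrite lee_fin.
have mfphi n : measurable_fun setT (fun t => f_ n (phi t)).
  by apply: measurableT_comp.
transitivity (limn (fun n => \int[mu]_t (g t * f_ n (phi t))%:E)%E).
  rewrite -monotone_convergence//.
  - apply: eq_integral => t _; apply/esym/cvg_lim => //.
    under eq_fun do rewrite EFinM.
    by rewrite EFinM; exact/cvgeZl/cvf.
  - by move=> n; exact/measurable_EFinP/measurable_funM.
  - by move=> n t _; rewrite lee_fin mulr_ge0.
  - by move=> t _ a b ab; rewrite lee_fin ler_wpM2l// ndf.
transitivity (limn (fun n => c%:E * \int[nu]_y (f_ n y)%:E)%E); last first.
  rewrite limeMl//; last first.
    apply: ereal_nondecreasing_is_cvgn => a b ab; apply: ge0_le_integral => //.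
    - by move=> y _; rewrite lee_fin.
    - exact/measurable_EFinP.
    - exact/measurable_EFinP.
    - by move=> y _; rewrite lee_fin ndf.
  congr (_ * _)%E; rewrite -monotone_convergence//.
  - by apply: eq_integral => t _; exact/cvg_lim/cvf.
  - by move=> n; exact/measurable_EFinP.
  - by move=> n t _; rewrite lee_fin.
  - by move=> t _ a b ab; rewrite lee_fin ndf.
congr (limn _); apply/funext => n.
have mpre r : measurable (f_ n @^-1` [set r]) by exact: measurable_funPTI.
have mind r :
    measurable_fun setT (fun t => \1_(f_ n @^-1` [set r]) (phi t) : R).
  exact: measurableT_comp.
have ge0 r y : 0 <= r * \1_(f_ n @^-1` [set r]) y.
  by have := nnfun_muleindic_ge0 (f_ n) r y; rewrite -EFinM lee_fin.
transitivity (\sum_(r \in range (f_ n))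
    \int[mu]_t (g t * (r * \1_(f_ n @^-1` [set r]) (phi t)))%:E)%E.
  under eq_integral do rewrite fimfunE mulr_fsumr//= -fsumEFin//.
  rewrite ge0_integral_fsum//.
  - move=> r; apply/measurable_EFinP/measurable_funM => //.
    exact: measurable_funM.
  - by move=> r t _; rewrite lee_fin mulr_ge0.
transitivity
  (c%:E * \sum_(r \in range (f_ n)) (r%:E * nu (f_ n @^-1` [set r])))%E.
  rewrite ge0_mule_fsumr; last by move=> r; exact: nnsfun_mulemu_ge0.
  apply: eq_fsbigr => r /[!inE] -[y _ yr].
  have r0 : 0 <= r by rewrite -yr.
  under eq_integral do rewrite mulrCA EFinM.
  rewrite ge0_integralZl_EFin//; last 2 first.
  - by move=> t _; rewrite lee_fin mulr_ge0.
  - exact/measurable_EFinP/measurable_funM.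
  by rewrite gnu// muleCA.
congr (_ * _)%E; by rewrite integralT_nnsfun sintegralE.
Qed.

End indicator_extension.

(** * Gaussian integrals and the Gaussian moment generating function *)

Lemma integral_normal_prob_indic (R : realType) (A : set R) : measurable A ->
  (\int[normal_prob 0 1]_x (\1_A x)%:E = normal_prob 0 1 A)%E.
Proof. by move=> mA; rewrite integral_indic ?setIT. Qed.

(** Completing the square: the standard density times [expR (a * x)] is [expR (a ^+ 2 / 2)] times
    the normal density centred at [a], whose mass is 1. *)
Lemma integral_expR_normal_prob (R : realType) (a : R) :
  (\int[normal_prob 0 1]_x (expR (a * x))%:E = (expR (a ^+ 2 / 2))%:E)%E.
Proof.
have me : measurable_fun [set: R] (fun x => expR (a * x)).
  by apply: measurableT_comp => //; exact: measurable_funM.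
have pdf_indic (A : set R) :
    (\int[lebesgue_measure]_x (normal_pdf 0 1 x * \1_A x)%:E =
     normal_prob 0 1 A)%E.
  rewrite /normal_prob [RHS]integral_mkcond.
  apply: eq_integral => x _; rewrite patchE indicE.
  by case: ifPn => _; rewrite ?mulr1 ?mulr0.
have := @ge0_integral_indic_ext _ _ _ _ R lebesgue_measure (normal_prob 0 1)
  id (normal_pdf 0 1) 1 (@measurable_id _ _ _) (measurable_normal_pdf 0 1)
  (normal_pdf_ge0 0 1) _ _ me (fun=> expR_ge0 _).
rewrite mul1e => <-; last by move=> A _; rewrite mul1e; exact: pdf_indic.
have -> : (fun x : R => (normal_pdf 0 1 x * expR (a * x))%:E) =
          (fun x => (expR (a ^+ 2 / 2))%:E * (normal_pdf a 1 x)%:E)%E.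
  apply/funext => x; rewrite !normal_pdfE ?oner_eq0// -EFinM; congr (_%:E).
  rewrite mulrCA -mulrA -!expRD; congr (_ * expR _).
  by field.
rewrite integralZl//; last exact: integrable_normal_pdf.
by rewrite integral_normal_pdf mule1.
Qed.

Section gaussian_vector.
Context {R : realType} {dT : measure_display} {T : measurableType dT}.
Variables (P : probability T R) (d : nat) (X : T -> 'rV[R]_d).
Hypothesis mX : forall k : 'I_d, measurable_fun setT (fun t => X t 0 k).
Hypothesis gX : std_gaussian_vec P X.

(** Stands in for independence of the coordinates, which [std_gaussian_vec] expresses only on
    rectangles, that is, for products of indicators. *)
Lemma integral_prod_gaussian (f : 'I_d -> R -> R) (c : 'I_d -> R) :
  (forall k, measurable_fun setT (f k)) -> (forall k x, 0 <= f k x) ->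
  (forall k, (\int[normal_prob 0 1]_x (f k x)%:E = (c k)%:E)%E) ->
  (\int[P]_t (\prod_(k < d) f k (X t 0%R k))%:E = (\prod_(k < d) c k)%:E)%E.
Proof.
suff H n : forall (f : 'I_d -> R -> R) (c : 'I_d -> R),
    (forall k, measurable_fun setT (f k)) -> (forall k x, 0 <= f k x) ->
    (forall k, (\int[normal_prob 0 1]_x (f k x)%:E = (c k)%:E)%E) ->
    (forall k : 'I_d, (n <= k)%N -> exists2 A, measurable A & f k = \1_A) ->
    (\int[P]_t (\prod_(k < d) f k (X t 0%R k))%:E = (\prod_(k < d) c k)%:E)%E.
  move=> mf f0 fc; apply: (H d) => // k.
  by rewrite leqNgt ltn_ord.
(* The functions [f k] with [k < n] are arbitrary, the others indicators; one
   indicator at a time is traded for a function. *)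
elim: n => [|n IH] {}f {}c mf f0 fc fA.
  have /choice[A AP] : forall k, exists A, measurable A /\ f k = \1_A.
    by move=> k; have [//|A mA fE] := fA k; exists A.
  have mA k : measurable (A k) by have [] := AP k.
  have cE k : (c k)%:E = normal_prob 0 1 (A k).
    by rewrite -fc (AP k).2 integral_normal_prob_indic.
  transitivity (\prod_(k < d) (c k)%:E)%E; last exact: prodEFin.
  rewrite (eq_bigr _ (fun k _ => cE k)) -gX// -[in RHS](setIT [set t | _]).
  rewrite -integral_indic//; last first.
    rewrite (_ : [set t | _] =
      \bigcap_(k in [set: 'I_d]) ((fun t => X t 0 k) @^-1` A k)).
      apply: fin_bigcap_measurable => // k _.
      by rewrite -[_ @^-1` _]setTI; exact: mX.
    by apply/seteqP; split=> t /= H k => [_|]; exact: H.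
  apply: eq_integral => t _; congr (_%:E).
  rewrite indicE; case: (boolP (t \in _)) => [/set_mem/= H|/negP H].
    by rewrite big1// => k _; rewrite (AP k).2 indicE mem_set.
  have [k Hk] : exists k, ~ A k (X t 0 k).
    by apply/existsNP => H'; apply: H; exact/mem_set.
  by rewrite (bigD1 k)//= (AP k).2 indicE memNset// mul0r.
(* When [d <= n] no coordinate has index [n] or more, so the side condition of [IH] is vacuous. *)
have [nd|dn] := ltnP n d; last first.
  apply: IH => // k nk; apply: fA; have := ltn_ord k.
  by move/(leq_trans)/(_ dn)/leq_trans/(_ nk); rewrite ltnn.
pose j := Ordinal nd.
rewrite (bigD1 j)//= mulrC EFinM -(fc j).
under eq_integral do rewrite (bigD1 j)//= mulrC.
apply: (@ge0_integral_indic_ext _ _ _ _ R P (normal_prob 0 1)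
  (fun t => X t 0 j) (fun t => \prod_(k < d | k != j) f k (X t 0 k))) => //.
- exact: mX.
- apply: (eq_measurable_fun
    (fun t => \prod_(k < d) if k != j then f k (X t 0 k) else 1)).
    by move=> t _; rewrite -big_mkcond.
  apply: measurable_prod => k _; case: (k != j) => //.
  exact: measurableT_comp.
- by move=> t; rewrite prodr_ge0.
move=> A mA.
have Afin : normal_prob 0 1 A \is a fin_num by exact: fin_num_measure.
(* With factor [j] turned back into an indicator, the induction hypothesis evaluates the
   integral. *)
pose f' k := if k == j then \1_A else f k.
pose c' k := if k == j then fine (normal_prob 0 1 A) else c k.
transitivity (\prod_(k < d) c' k)%:E; last first.
  rewrite (bigD1 j)//= {1}/c' eqxx mulrC EFinM fineK//; congr (_%:E * _)%E.
  by apply: eq_bigr => k /negbTE kj; rewrite /c' kj.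
rewrite -(IH f').
- apply: eq_integral => t _; congr (_%:E).
  rewrite [RHS](bigD1 j)//= {1}/f' eqxx mulrC; congr (_ * _).
  by apply: eq_bigr => k /negbTE kj; rewrite /f' kj.
- by move=> k; rewrite /f'; case: ifP.
- by move=> k x; rewrite /f'; case: ifP.
- move=> k; rewrite /f' /c'; case: ifP => // _.
  by rewrite integral_normal_prob_indic ?fineK.
- move=> k nk; rewrite /f'; case: eqVneq => [_|kj]; first by exists A.
  by apply: fA; rewrite ltn_neqAle nk andbT eq_sym.
- exact: mf.
Qed.

Lemma gaussian_mgf (z : 'rV[R]_d) :
  (\int[P]_t (expR (dotv (X t) z))%:E = (expR (norm2 z ^+ 2 / 2))%:E)%E.
Proof.
under eq_integral do rewrite /dotv expR_sum.
have := @integral_prod_gaussian (fun k x => expR (z 0 k * x))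
  (fun k => expR (z 0 k ^+ 2 / 2)).
under eq_integral do (under eq_bigr do rewrite mulrC).
move=> ->; last 3 first.
- by move=> k; apply: measurableT_comp => //; exact: measurable_funM.
- by move=> k x; exact: expR_ge0.
- by move=> k; exact: integral_expR_normal_prob.
rewrite -expR_sum -mulr_suml /norm2 sqr_sqrtr// sumr_ge0// => k _.
exact: sqr_ge0.
Qed.

End gaussian_vector.

(** * Laws of random row vectors *)

Section row_vector_law.
Context {R : realType}.

(* [same_law] only speaks of these sets, so row vectors are measured with the
   sigma-algebra they generate. *)
Definition rectangles d : set (set 'rV[R]_d) :=
  [set B | exists2 A : 'I_d -> set R, (forall k, measurable (A k)) &
           B = [set v : 'rV[R]_d | forall k, A k (v 0 k)]].

Lemma measurable_coord d (k : 'I_d) :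
  measurable_fun setT (fun v : g_sigma_algebraType (rectangles d) => v 0 k).
Proof.
move=> _ A mA; rewrite setTI; apply: sub_sigma_algebra.
exists (fun l => if l == k then A else setT).
  by move=> l; case: ifP.
apply/seteqP; split => v /=.
  by move=> Av l; case: eqP => // ->.
by move=> /(_ k); rewrite eqxx.
Qed.

Context {dT : measure_display} {T : measurableType dT}.

Lemma measurable_rV d (X : T -> 'rV[R]_d) :
  (forall k, measurable_fun setT (fun t => X t 0 k)) ->
  measurable_fun setT (X : T -> g_sigma_algebraType (rectangles d)).
Proof.
move=> mX; apply: (@measurability _ _ _ (g_sigma_algebraType (rectangles d))
  _ _ (rectangles d)) => //.
move=> _ [_ [A mA ->] <-].
rewrite setTI (_ : _ @^-1` _ =
  \bigcap_(k in [set: 'I_d]) ((fun t => X t 0 k) @^-1` A k)).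
  apply: fin_bigcap_measurable => // k _.
  by rewrite -[_ @^-1` _]setTI; exact: mX.
by apply/seteqP; split=> t /= H k => [_|]; exact: H.
Qed.

(** The two image laws agree on rectangles, which are stable under intersection and include the
    whole space; finite measures that agree on such a class agree on the sigma-algebra it
    generates. *)
Lemma same_law_integral (P : probability T R) d (X Y : T -> 'rV[R]_d)
    (f : 'rV[R]_d -> R) :
  (forall k, measurable_fun setT (fun t => X t 0 k)) ->
  (forall k, measurable_fun setT (fun t => Y t 0 k)) ->
  same_law P X Y ->
  measurable_fun setT (f : g_sigma_algebraType (rectangles d) -> R) ->
  (forall v, 0 <= f v) ->
  (\int[P]_t (f (X t))%:E = \int[P]_t (f (Y t))%:E)%E.
Proof.
move=> mX mY XY mf f0.
have mX' := measurable_rV _ _ mX; have mY' := measurable_rV _ _ mY.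
have mEf : measurable_fun setT
    (EFin \o (f : g_sigma_algebraType (rectangles d) -> R)).
  exact/measurable_EFinP.
have f0' : {in setT, forall v, 0 <= (EFin \o f) v}%E.
  by move=> v _; rewrite lee_fin.
have := ge0_integral_pushforward mX' P measurableT mEf f0'.
have := ge0_integral_pushforward mY' P measurableT mEf f0'.
rewrite /= => <- <-; apply: eq_measure_integral => B mB _.
apply: (@measure_unique _ _ (g_sigma_algebraType (rectangles d))
  (rectangles d) (fun=> setT)) => //.
- move=> _ _ [A mA ->] [A' mA' ->]; exists (fun k => A k `&` A' k).
    by move=> k; exact: measurableI.
  apply/seteqP; split => v /=; first by move=> [Av A'v] k; split.
  by move=> Av; split=> k; have [] := Av k.
- move=> _; exists (fun=> setT) => //.
  by apply/seteqP; split.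
- by rewrite bigcup_const.
- by move=> _ [A mA ->]; exact: XY.
- by move=> _; rewrite /= /pushforward preimage_setT probability_setT ltry.
Qed.

End row_vector_law.

(** * Dot products and Householder reflections *)

Section householder.
Context {R : realType}.
Variable d : nat.
Implicit Types a b v : 'rV[R]_d.

Lemma dotvC a b : dotv a b = dotv b a.
Proof. by apply: eq_bigr => k _; rewrite mulrC. Qed.

Lemma dotvE a b : dotv a b = (a *m b^T) 0 0.
Proof. by rewrite mxE; apply: eq_bigr => k _; rewrite mxE. Qed.

Lemma norm2_sqr a : norm2 a ^+ 2 = dotv a a.
Proof.
rewrite /norm2 sqr_sqrtr; last by rewrite sumr_ge0// => k _; exact: sqr_ge0.
by apply: eq_bigr => k _; rewrite expr2.
Qed.

Lemma dotvv_ge0 a : 0 <= dotv a a.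
Proof. by rewrite -norm2_sqr sqr_ge0. Qed.

Lemma norm2_ge0 a : 0 <= norm2 a.
Proof. exact: sqrtr_ge0. Qed.

Lemma norm2E a : norm2 a = Num.sqrt (dotv a a).
Proof. by rewrite -norm2_sqr sqrtr_sqr ger0_norm// norm2_ge0. Qed.

Lemma dotvDl a b v : dotv (a + b) v = dotv a v + dotv b v.
Proof. by rewrite !dotvE mulmxDl mxE. Qed.

Lemma dotvBl a b v : dotv (a - b) v = dotv a v - dotv b v.
Proof. by rewrite !dotvE mulmxBl !mxE. Qed.

Lemma dotvZl c a v : dotv (c *: a) v = c * dotv a v.
Proof. by rewrite !dotvE -scalemxAl mxE. Qed.

Lemma dotvv_eq0 a : dotv a a = 0 -> a = 0.
Proof.
move=> /eqP; rewrite psumr_eq0; last by move=> k _; rewrite -expr2 sqr_ge0.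
move=> /allP H; apply/rowP => k; rewrite mxE.
by have := H k (mem_index_enum k); rewrite -expr2 sqrf_eq0 => /eqP.
Qed.

(** For [a != b], the reflection in the hyperplane orthogonal to [a - b] exchanges [a] and [b]
    exactly because their norms agree. *)
Lemma householder a b : norm2 a = norm2 b ->
  exists2 Q : 'M[R]_d, Q *m Q^T = 1%:M & forall v, dotv (v *m Q) b = dotv v a.
Proof.
move=> ab; have [->|neq_ab] := eqVneq a b.
  exists 1%:M; first by rewrite trmx1 mulmx1.
  by move=> v; rewrite mulmx1.
pose n := a - b.
have n0 : dotv n n != 0.
  by apply: contra_neq neq_ab => /dotvv_eq0/eqP; rewrite subr_eq0 => /eqP.
pose s := 2 / dotv n n.
pose Q : 'M[R]_d := 1%:M - s *: (n^T *m n).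
have QT : Q^T = Q by rewrite /Q linearB/= linearZ/= trmx_mul trmxK trmx1.
have nnT : n *m n^T = (dotv n n)%:M.
  by apply/matrixP => i j; rewrite !ord1 dotvE [RHS]mxE eqxx.
have vQ v : v *m Q = v - (s * dotv v n) *: n.
  rewrite mulmxBr mulmx1 -scalemxAr mulmxA; congr (_ - _).
  have -> : v *m n^T = (dotv v n)%:M.
    by apply/matrixP => i j; rewrite !ord1 dotvE [RHS]mxE eqxx.
  by rewrite mul_scalar_mx scalerA.
have nb : dotv n b = - (dotv n n / 2).
  have : dotv a a = dotv b b by rewrite -!norm2_sqr ab.
  rewrite /n !dotvBl !(dotvC _ (a - b)) !dotvBl (dotvC b a) => ->.
  by field.
exists Q.
  (* [Q] is symmetric, so orthogonality says that reflecting twice is the identity: the coefficient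
     of [n] cancels since [s * dotv n n = 2]. *)
  rewrite QT; apply/row_matrixP => i; rewrite !rowE mulmxA mulmx1 vQ vQ.
  set e := delta_mx 0 i; rewrite dotvBl dotvZl -addrA -opprD -scalerDl.
  rewrite [X in X *: n](_ : _ = 0) ?scale0r ?subr0//.
  by rewrite /s; field.
move=> v; have -> : dotv v a = dotv v b + dotv v n.
  by rewrite (dotvC v n) dotvBl !(dotvC v) addrC subrK.
by rewrite vQ dotvBl dotvZl nb /s; field.
Qed.

End householder.

(** * Rotation invariance expressed on integrals *)

Section rotation.
Context {R : realType} {dT : measure_display} {T : measurableType dT}.

Lemma measurable_dotv d (X Y : T -> 'rV[R]_d) :
  (forall k, measurable_fun setT (fun t => X t 0 k)) ->
  (forall k, measurable_fun setT (fun t => Y t 0 k)) ->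
  measurable_fun setT (fun t => dotv (X t) (Y t)).
Proof. by move=> mX mY; apply: measurable_sum => k; exact: measurable_funM. Qed.

End rotation.

Section rotation_integral.
Context {R : realType} {dT : measure_display} {T : measurableType dT}.
Variables (P : probability T R) (d : nat) (u : T -> 'rV[R]_d).
Hypothesis mu : forall k, measurable_fun setT (fun t => u t 0 k).
Hypothesis rotu : rot_invariant P u.

(** The orthogonal matrix from [householder] changes the direction [b] into [a] and preserves the
    squared norm. Since the first argument of [h] is a squared norm, nonnegativity is asked only for
    [0 <= p.1]; this admits odd powers of that argument. *)
Lemma rot_invariant_integral (a b : 'rV[R]_d) (h : R * R -> R) :
  norm2 a = norm2 b -> measurable_fun setT h ->
  (forall p, 0 <= p.1 -> 0 <= h p) ->
  (\int[P]_t (h (dotv (u t) (u t), dotv (u t) a))%:E =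
   \int[P]_t (h (dotv (u t) (u t), dotv (u t) b))%:E)%E.
Proof.
move=> ab mh h0; have [Q QQ Qba] := householder _ _ _ ab.
pose f v := h (dotv v v, dotv v b).
have -> : (fun t => (h (dotv (u t) (u t), dotv (u t) a))%:E) =
          (fun t => (f (u t *m Q))%:E).
  apply/funext => t; rewrite /f Qba; congr (h (_, _))%:E.
  by rewrite !dotvE trmx_mul mulmxA -(mulmxA _ Q) QQ mulmx1.
apply/esym/same_law_integral => //.
- move=> k; under eq_fun do rewrite mxE.
  by apply: measurable_sum => i; exact: measurable_funM.
- exact: rotu.
- apply: measurableT_comp => //; apply: measurable_fun_pair.
    by apply: measurable_dotv => k; exact: measurable_coord.
  by apply: measurable_dotv => k //; exact: measurable_coord.
- by move=> v; apply: h0; exact: dotvv_ge0.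
Qed.

End rotation_integral.

(** * Moments of a rotation-invariant vector *)

Lemma eq_poly_horner (R : numDomainType) (p q : {poly R}) :
  (forall x, p.[x] = q.[x]) -> p = q.
Proof.
move=> pq; apply/eqP; rewrite -subr_eq0; apply/negPn/negP => p0.
(* These are distinct roots of [p - q], one more than its degree allows. *)
pose rs : seq R := [seq n%:R | n <- iota 0 (size (p - q))].
have rsP : all (root (p - q)) rs.
  by apply/allP => x _; rewrite rootE hornerD hornerN pq subrr.
have rsU : uniq rs.
  by rewrite map_inj_uniq ?iota_uniq// => m n /eqP; rewrite eqr_nat => /eqP.
by have := max_poly_roots p0 rsP rsU; rewrite size_map size_iota ltnn.
Qed.

Lemma Rintegral_sum d (T : measurableType d) (R : realType)
    (m : {measure set T -> \bar R}) (D : set T) (I : Type) (r : seq I)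
    (f : I -> T -> R) :
  measurable D -> (forall i, m.-integrable D (EFin \o f i)) ->
  \int[m]_(x in D) (\sum_(i <- r) f i x) = \sum_(i <- r) \int[m]_(x in D) f i x.
Proof.
move=> mD fi; elim: r => [|i r IH].
  rewrite big_nil; under eq_Rintegral do rewrite big_nil.
  by rewrite Rintegral_cst// mul0r.
rewrite big_cons; under eq_Rintegral do rewrite big_cons.
rewrite RintegralD ?IH//.
rewrite (_ : EFin \o _ = (fun x => \sum_(j <- r) (f j x)%:E)%E).
  by apply: integrable_sum => // k _; exact: fi.
by apply/funext => x; rewrite /= sumEFin.
Qed.

Lemma dotv_delta (R : realType) d (v : 'rV[R]_d) k :
  dotv v (delta_mx 0 k) = v 0 k.
Proof.
rewrite /dotv (bigD1 k)//= big1 ?addr0 ?mxE ?eqxx ?mulr1// => i /negbTE ik.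
by rewrite mxE eqxx ik mulr0.
Qed.

Section moments.
Context {R : realType} {dT : measure_display} {T : measurableType dT}.
Variables (P : probability T R) (d : nat) (u : T -> 'rV[R]_d.+1).
Hypothesis mu : forall k, measurable_fun setT (fun t => u t 0 k).
Hypothesis rotu : rot_invariant P u.
Hypothesis mom : forall n,
  P.-integrable setT (fun t => (dotv (u t) (u t) ^+ n)%:E).

Let s t := dotv (u t) (u t).

Let ms : measurable_fun setT s. Proof. exact: measurable_dotv. Qed.

Let s_ge0 t : 0 <= s t.
Proof. exact: dotvv_ge0. Qed.

(** Every coordinate is at most [|u|] in absolute value, so the monomial is dominated by
    [|u|^(2(j+k))]. *)
Lemma integrable_monomial j k i (b : 'I_d.+1) : (i <= k.*2)%N ->
  P.-integrable setT
    (fun t => (s t ^+ j * (u t 0 0 ^+ (k.*2 - i) * u t 0 b ^+ i))%:E).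
Proof.
move=> ik; apply: le_integrable (mom (j + k)%N) => //.
  apply/measurable_EFinP; apply: measurable_funM; first exact: measurable_funX.
  by apply: measurable_funM; exact: measurable_funX.
move=> t _; rewrite /= lee_fin [leRHS]ger0_norm ?exprn_ge0 ?s_ge0// exprD.
rewrite normrM ger0_norm ?exprn_ge0// ler_wpM2l ?exprn_ge0 ?s_ge0//.
rewrite normrM !normrX.
have us c : `|u t 0 c| <= Num.sqrt (s t).
  rewrite -sqrtr_sqr ler_sqrt// /s /dotv (bigD1 c)//= -expr2 lerDl.
  by rewrite sumr_ge0// => l _; rewrite -expr2 sqr_ge0.
have -> : dotv (u t) (u t) ^+ k =
    Num.sqrt (s t) ^+ (k.*2 - i) * Num.sqrt (s t) ^+ i.
  by rewrite -exprD subnK// -mul2n exprM sqr_sqrtr.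
by rewrite ler_pM ?exprn_ge0// lerXn2r ?nnegrE ?sqrtr_ge0.
Qed.

Let M j k := \int[P]_t (s t ^+ j * u t 0 0 ^+ k.*2).

Let mixed_moment j k (b : 'I_d.+1) : b != 0 ->
  (k.*2.+1)%:R * \int[P]_t (s t ^+ j * (u t 0 0 ^+ k.*2 * u t 0 b ^+ 2)) =
  M j k.+1.
Proof.
move=> b0.
pose m i := \int[P]_t (s t ^+ j * (u t 0 0 ^+ (k.+1.*2 - i) * u t 0 b ^+ i)).
(* The two sides, as polynomials in x, of the invariance of
   E |u|^(2j) (u.a)^(2k+2) when a = e_0 + x e_b is rotated to
   sqrt(1+x^2) e_0. *)
pose p : {poly R} := \sum_(i < k.+1.*2.+1) ('C(k.+1.*2, i)%:R * m i) *: 'X^i.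
pose q : {poly R} := M j k.+1 *: ('X^2 + 1) ^+ k.+1.
have pq : p = q.
  apply: eq_poly_horner => x.
  pose a : 'rV[R]_d.+1 := delta_mx 0 0 + x *: delta_mx 0 b.
  pose a' : 'rV[R]_d.+1 := Num.sqrt (1 + x ^+ 2) *: delta_mx 0 0.
  have ua (v : 'rV[R]_d.+1) : dotv v a = v 0 0 + x * v 0 b.
    by rewrite dotvC dotvDl dotvZl !(dotvC _ _ v) !dotv_delta.
  have ua' (v : 'rV[R]_d.+1) : dotv v a' = Num.sqrt (1 + x ^+ 2) * v 0 0.
    by rewrite dotvC dotvZl (dotvC _ _ v) dotv_delta.
  have x2 : 0 <= 1 + x ^+ 2 by rewrite addr_ge0// sqr_ge0.
  have na : norm2 a = norm2 a'.
    rewrite !norm2E ua ua' !mxE !eqxx/= eq_sym (negbTE b0) !mulr1.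
    by rewrite mulr0 addr0 add0r -!expr2 sqr_sqrtr.
  have h2 : measurable_fun setT (fun v : R * R => v.1 ^+ j * v.2 ^+ k.+1.*2).
    by apply: measurable_funM; exact: measurable_funX.
  have h0 (v : R * R) : 0 <= v.1 -> 0 <= v.1 ^+ j * v.2 ^+ k.+1.*2.
    move=> v0; apply: mulr_ge0; first exact: exprn_ge0.
    by rewrite -mul2n exprM exprn_ge0// sqr_ge0.
  have := rot_invariant_integral P _ u mu rotu _ _ _ na h2 h0.
  rewrite /= => /(congr1 fine) H.
  transitivity (\int[P]_t (s t ^+ j * (dotv (u t) a) ^+ k.+1.*2)).
    transitivity (\int[P]_t (\sum_(i < k.+1.*2.+1)
        ('C(k.+1.*2, i)%:R * x ^+ i) *
        (s t ^+ j * (u t 0 0 ^+ (k.+1.*2 - i) * u t 0 b ^+ i)))); last first.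
      apply: eq_Rintegral => t _; rewrite ua exprDn mulr_sumr.
      by apply: eq_bigr => i _; rewrite exprMn -[in RHS]mulr_natl; ring.
    rewrite Rintegral_sum//; last first.
      move=> i; rewrite (_ : EFin \o _ =
        (fun t => ('C(k.+1.*2, i)%:R * x ^+ i)%:E *
        (s t ^+ j * (u t 0 0 ^+ (k.+1.*2 - i) * u t 0 b ^+ i))%:E)%E)//.
      by apply: integrableZl => //; apply: integrable_monomial; rewrite -ltnS.
    rewrite horner_sum; apply: eq_bigr => i _.
    rewrite RintegralZl//; last by apply: integrable_monomial; rewrite -ltnS.
    by rewrite hornerZ hornerXn mulrAC.
  transitivity (\int[P]_t (s t ^+ j * (dotv (u t) a') ^+ k.+1.*2)).
    exact: H.
  transitivity (\int[P]_t ((1 + x ^+ 2) ^+ k.+1 *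
      (s t ^+ j * u t 0 0 ^+ k.+1.*2))).
    apply: eq_Rintegral => t _; rewrite ua' exprMn.
    have -> : Num.sqrt (1 + x ^+ 2) ^+ k.+1.*2 = (1 + x ^+ 2) ^+ k.+1.
      by rewrite -mul2n exprM sqr_sqrtr.
    by rewrite mulrCA.
  rewrite RintegralZl//.
    by rewrite /q hornerZ horner_exp hornerD hornerXn hornerC mulrC addrC.
  have := @integrable_monomial j k.+1 0 0 isT.
  by under [X in _.-integrable _ X]eq_fun do rewrite expr0 mulr1 subn0.
have p2 : p`_2 = 'C(k.+1.*2, 2)%:R * m 2.
  rewrite coef_sum; under eq_bigr do rewrite coefZ coefXn.
  have k2 : (2 < k.+1.*2.+1)%N by rewrite doubleS.
  rewrite (bigD1 (Ordinal k2))//= mulr1 big1 ?addr0// => i /negbTE i2.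
  by rewrite eq_sym (_ : (i == 2 :> nat) = false) ?mulr0.
have q2 : q`_2 = M j k.+1 * k.+1%:R.
  rewrite /q addrC exprDn coefZ coef_sum; congr (_ * _).
  under eq_bigr do rewrite expr1n mul1r -exprM coefMn coefXn.
  have k1 : (1 < k.+2)%N by [].
  rewrite (bigD1 (Ordinal k1))//= big1 ?addr0 ?bin1// => i /negbTE i1.
  rewrite (_ : (2 == 2 * i)%N = false) ?mul0rn//.
  rewrite -[X in X == _]muln1 eqn_pmul2l//.
  by apply/eqP => i1'; move/eqP: i1; apply; exact/val_inj.
(* Both coefficients of [x^2] carry the factor [k.+1]; cancelling it leaves [k.*2.+1]. *)
have binE : 'C(k.+1.*2, 2) = (k.*2.+1 * k.+1)%N.
  by rewrite bin2 -doubleMl doubleK doubleS mulnC.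
have k0 : k.+1%:R != 0 :> R by rewrite pnatr_eq0.
apply: (mulIf k0); rewrite -q2 -pq p2 binE /m doubleS subSS subSS subn0.
by rewrite natrM mulrAC.
Qed.

Lemma moment_recurrence j k :
  (k.*2.+1)%:R * M j.+1 k = (k.*2 + d.+1)%:R * M j k.+1.
Proof.
have -> : M j.+1 k = \sum_(b < d.+1)
    \int[P]_t (s t ^+ j * (u t 0 0 ^+ k.*2 * u t 0 b ^+ 2)).
  rewrite -Rintegral_sum//; last first.
    move=> b; have := @integrable_monomial j k.+1 2%N b isT.
    by rewrite doubleS !subSS subn0.
  apply: eq_Rintegral => t _; rewrite exprSr {2}/s /dotv.
  rewrite -mulr_sumr -mulr_sumr -mulrA; congr (_ * _); rewrite mulrC.
  by congr (_ * _); apply: eq_bigr => b _; rewrite expr2.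
(* The summand [b = 0] is [M j k.+1] and keeps its factor [2k+1]; each of the [d] other coordinates
   contributes one [M j k.+1] by [mixed_moment]. The total factor is [2k+1+d]. *)
rewrite mulr_sumr (bigD1 0)//= (eq_bigr (fun=> M j k.+1)); last first.
  by move=> b b0; exact: mixed_moment.
rewrite sumr_const cardC1 card_ord -mulr_natl.
rewrite (_ : \int[P]_t _ = M j k.+1); last first.
  by apply: eq_Rintegral => t _; rewrite -exprD addn2 -doubleS.
by rewrite -[X in _ = _%:R * X]mul1r; ring.
Qed.
End moments.

(** * The Gamma function at half-integers *)

Section gamma.
Context {R : realType}.
Notation mu := (@lebesgue_measure R).

Let integrand (s t : R) := t `^ (s - 1) * expR (- t).
(** The Gamma integral before [fine]: with extended real values its recurrence can be proved before
    its finiteness is known. *)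
Definition egamma (s : R) : \bar R :=
  (\int[mu]_(t in `]0%R, +oo[%classic) (integrand s t)%:E)%E.

Let integrand_ge0 s t : 0 <= integrand s t.
Proof. by rewrite mulr_ge0 ?powR_ge0 ?expR_ge0. Qed.

Let measurable_integrand s D : measurable_fun D (integrand s).
Proof.
apply: measurable_funTS; apply: measurable_funM; first exact: measurable_powR.
by apply: measurableT_comp => //; exact: measurable_funN.
Qed.

(** Comes from raising [t / (s + 1) <= expR (t / (s + 1))] to the power [s + 1]. It controls the
    boundary term at infinity in the integration by parts. *)
Lemma powR_expRN_le (s t : R) : 0 < s -> 0 < t ->
  t `^ s * expR (- t) <= (s + 1) `^ (s + 1) / t.
Proof.
move=> s0 t0; have s1 : 0 < s + 1 by rewrite addr_gt0.
rewrite expRN -ler_pdivlMr ?invr_gt0 ?expR_gt0// invrK mulrAC ler_pdivlMr//.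
rewrite -{2}(powRr1 (ltW t0)) -powRD; last by rewrite gt_eqF// implybT.
have -> : expR t = expR (t / (s + 1)) `^ (s + 1).
  by rewrite -expRM divfK ?gt_eqF.
rewrite -powRM ?(ltW s1) ?expR_ge0// ge0_ler_powR ?nnegrE ?(ltW s1) ?(ltW t0)//.
  by rewrite mulr_ge0 ?(ltW s1) ?expR_ge0.
rewrite -ler_pdivrMl// mulrC (le_trans _ (expR_ge1Dx _))//.
by rewrite lerDr.
Qed.

(** The compact intervals [[a n, b n]] exhaust the open half-line and avoid the possible singularity
    at 0. The shift by two in [b] keeps [a n < b n] at [n = 0], where [a n = 1]. *)
Let a (n : nat) : R := n.+1%:R^-1.
Let b (n : nat) : R := n.+2%:R.

Let a0 n : 0 < a n. Proof. by rewrite invr_gt0. Qed.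
Let ab n : a n < b n.
Proof. by rewrite (@le_lt_trans _ _ 1)// ?invf_le1// ?ler1n// ltr1n. Qed.

Let cvg_integral s :
  (\int[mu]_(t in `[a n, b n]) (integrand s t)%:E)%E @[n --> \oo] --> egamma s.
Proof.
have -> : egamma s =
    (\int[mu]_(t in \bigcup_n `[a n, b n]%classic) (integrand s t)%:E)%E.
  congr (integral _ _ _); apply/seteqP; split => t/=.
    rewrite in_itv/= andbT => t0.
    (* An integer above [t + t^-1] exceeds both [t] and [t^-1], as the two endpoints require. *)
    exists (Num.truncn (t + t^-1)).+1 => //=.
    have := truncnS_gt (t + t^-1); set N := Num.truncn _ => tN.
    have tN1 : t < N.+1%:R by rewrite (le_lt_trans _ tN)// lerDl invr_ge0 ltW.
    have tN2 : t^-1 < N.+1%:R by rewrite (le_lt_trans _ tN)// lerDr ltW.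
    rewrite in_itv/=; apply/andP; split.
      rewrite /a -[leRHS]invrK lef_pV2 ?posrE ?invr_gt0//.
      by rewrite ltW// (lt_le_trans tN2)// ler_nat.
    by rewrite ltW// (lt_le_trans tN1)// ler_nat ltnW.
  by move=> [n _]; rewrite /= !in_itv/= andbT => /andP[+ _]; exact: lt_le_trans.
apply: ge0_nondecreasing_set_cvg_integral => //.
- move=> m n mn; apply/subsetPset; apply: subset_itv; rewrite bnd_simp.
    by rewrite /a lef_pV2 ?posrE// ler_nat.
  by rewrite ler_nat.
- by move=> n; apply/measurable_EFinP; exact: measurable_integrand.
- by move=> n t _; rewrite lee_fin.
Qed.

Let by_parts s n : 0 < s ->
  (\int[mu]_(t in `[a n, b n]) (integrand (s + 1) t)%:E =
   (a n `^ s * expR (- a n) - b n `^ s * expR (- b n))%:E +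
   s%:E * \int[mu]_(t in `[a n, b n]) (integrand s t)%:E)%E.
Proof.
move=> s0.
have dP (r t : R) :
    0 < t -> is_derive t 1 (fun t : R => t `^ r) (r * t `^ (r - 1)).
  exact: is_derive1_powR.
have dE (t : R) : is_derive t 1 (fun t : R => - expR (- t)) (expR (- t)).
  by apply: is_derive_eq; rewrite mulrN1 opprK.
have dE' (t : R) : derivable (fun t : R => expR (- t)) t 1 by exact: ex_derive.
have itv_gt0 (t : R) : t \in `[a n, b n] -> 0 < t.
  by rewrite in_itv/= => /andP[+ _]; exact: lt_le_trans.
have cont (f : R -> R) (t : R) : derivable f t 1 -> {for t, continuous f}.
  by move=> /derivable1_diffP/differentiable_continuous.
have LR (f : R -> R) : (forall t, 0 < t -> derivable f t 1) ->
    derivable_oo_LRcontinuous f (a n) (b n).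
  move=> df; split.
  - move=> t tab; apply/df/itv_gt0; exact: subset_itv_oo_cc.
  - by apply/cvg_at_right_filter/cont/df.
  - by apply/cvg_at_left_filter/cont/df.
have := @integration_by_parts R (fun t => t `^ s) (fun t => - expR (- t))
  (fun t => s * t `^ (s - 1)) (fun t => expR (- t)) _ _ (ab n).
rewrite /integrand addrK => -> //.
- under [X in (_ - X)%E]eq_integral do rewrite mulrN EFinN -mulrA EFinM.
  rewrite integral_ge0N; last first.
    move=> t _; rewrite -EFinM lee_fin mulr_ge0 ?(ltW s0)//.
    by rewrite mulr_ge0 ?powR_ge0 ?expR_ge0.
  rewrite oppeK ge0_integralZl_EFin//; last exact: ltW.
  + by congr (_ + _)%E; congr (_%:E); ring.
  + by move=> t _; rewrite lee_fin mulr_ge0 ?powR_ge0 ?expR_ge0.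
  + by apply/measurable_EFinP; exact: measurable_integrand.
- apply: derivable_within_continuous => t /itv_gt0 t0.
  have ? := dP (s - 1) t t0; exact: ex_derive.
- by apply: LR => t t0; have ? := dP s t t0; exact: ex_derive.
- move=> t tab; rewrite derive1E.
  have ? := dP s t (itv_gt0 _ (subset_itv_oo_cc tab)).
  exact: derive_val.
- by apply: derivable_within_continuous => t _.
- by apply: LR => t t0.
- by move=> t _; rewrite derive1E; exact: derive_val.
Qed.

(** Passage to the limit in [by_parts]: the boundary term at [a n] vanishes because [s] is positive,
    the one at [b n] by [powR_expRN_le]. *)
Lemma egammaS s : 0 < s -> egamma (s + 1) = (s%:E * egamma s)%E.
Proof.
move=> s0; apply/esym.
have B0 : (a n `^ s * expR (- a n) - b n `^ s * expR (- b n))%:E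
    @[n --> \oo] --> 0%:E.
  apply: cvg_EFin; first exact: nearW.
  rewrite -[X in _ --> X](subr0 0); apply: cvgB.
    apply: (@squeeze_cvgr _ _ _ _ (fun=> 0) (fun n => a n `^ s)).
    - apply: nearW => n; rewrite mulr_ge0 ?powR_ge0 ?expR_ge0//=.
      by rewrite ler_piMr ?powR_ge0// -expR0 ler_expR oppr_le0 ltW.
    - exact: cvg_cst.
    - have /cvg_at_rightP := @powR_cvg0 R s s0; apply; split => //.
      exact: cvg_harmonic.
  (* The index is shifted because [harmonic n.+1] is the inverse of [b n]. *)
  apply: (@squeeze_cvgr _ _ _ _ (fun=> 0)
    (fun n => (s + 1) `^ (s + 1) * harmonic n.+1)).
  - apply: nearW => n; rewrite mulr_ge0 ?powR_ge0 ?expR_ge0//=.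
    exact: powR_expRN_le.
  - exact: cvg_cst.
  - rewrite -[X in _ --> X](mulr0 ((s + 1) `^ (s + 1))); apply: cvgM.
      exact: cvg_cst.
    by have := @cvg_harmonic R; rewrite -cvg_shiftS.
have : (\int[mu]_(t in `[a n, b n]) (integrand (s + 1) t)%:E)%E @[n --> \oo] -->
    (s%:E * egamma s)%E.
  under eq_cvg do rewrite by_parts//.
  set l := (_ * _)%E; rewrite -[l]add0e; apply: cvgeD => //.
  exact: cvgeZl.
by move=> H; apply: (cvg_unique _ H) => //; exact: cvg_integral.
Qed.

(** The integrand is the density of the exponential law of rate 1. *)
Lemma egamma1 : egamma 1 = 1%E.
Proof.
rewrite -(@integral_exponential_pdf R 1)// /egamma integral_itv_obnd_cbnd.
  rewrite integral_mkcond; apply: eq_integral => t _.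
  rewrite /exponential_pdf !patchE; case: ifPn => // _.
  by rewrite /integrand subrr powRr0 !mul1r mulN1r.
by apply/measurable_EFinP; exact: measurable_integrand.
Qed.

Lemma egammaD_le s1 s2 s3 :
  (forall t, 0 < t -> t `^ (s3 - 1) <= t `^ (s1 - 1) + t `^ (s2 - 1)) ->
  (egamma s3 <= egamma s1 + egamma s2)%E.
Proof.
move=> H; rewrite /egamma -ge0_integralD//.
- apply: ge0_le_integral => //.
  + by move=> t _; rewrite lee_fin.
  + by apply/measurable_EFinP; exact: measurable_integrand.
  + apply: emeasurable_funD; apply/measurable_EFinP;
      exact: measurable_integrand.
  + move=> t; rewrite /= in_itv/= andbT => t0.
    by rewrite -EFinD lee_fin /integrand -mulrDl ler_wpM2r ?expR_ge0 ?H.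
- by move=> t _; rewrite lee_fin.
- by apply/measurable_EFinP; exact: measurable_integrand.
- by move=> t _; rewrite lee_fin.
- by apply/measurable_EFinP; exact: measurable_integrand.
Qed.

(* Compare with egamma 1 = egamma 2 = 1, using t^(1/2) <= 1 + t and
   1 <= t^(-1/2) + t^(1/2). *)
Lemma egamma_half : (0 < egamma 2^-1 < +oo)%E.
Proof.
have half1 : 2^-1 <= 1 :> R by rewrite invf_le1// ler1n.
have e2 : egamma 2 = 1%E.
  by rewrite (_ : 2 = 1 + 1)// egammaS// egamma1 mule1.
have e32 : egamma (2^-1 + 1) = (2^-1%:E * egamma 2^-1)%E by rewrite egammaS.
have H1 : (egamma (2^-1 + 1) <= egamma 1 + egamma 2)%E.
  apply: egammaD_le => t t0; rewrite addrK subrr powRr0.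
  rewrite (_ : 2 - 1 = 1 :> R) ?powRr1 ?(ltW t0)//; last by ring.
  have [t1|/ltW t1] := leP 1 t.
    by rewrite ler_wpDl// -[leRHS]powRr1 ?(ltW t0)// ler_powR.
  rewrite ler_wpDr ?(ltW t0)//.
  have := @ge0_ler_powR R 2^-1 _ t 1 _ _ t1; rewrite powR1.
  by apply; rewrite ?nnegrE ?(ltW t0).
have H2 : (egamma 1 <= egamma 2^-1 + egamma (2^-1 + 1))%E.
  apply: egammaD_le => t t0; rewrite addrK subrr powRr0.
  have [t1|/ltW t1] := leP 1 t.
    by rewrite ler_wpDl ?powR_ge0// -{1}(powRr0 t) ler_powR.
  rewrite ler_wpDr ?powR_ge0// -{1}(powRr0 t) ger_powR ?t0 ?t1//.
  by rewrite subr_le0.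
move: H1 H2; rewrite egamma1 e2 e32; case: (egamma 2^-1) => [r| |]//=.
- rewrite -EFinM -!EFinD !lee_fin lte_fin ltry andbT => _; lra.
- by rewrite gt0_muley ?lte_fin// -EFinD leye_eq.
Qed.

(** The recurrence raises the argument by 1, hence [n] by two, so the induction has the two base
    cases 1/2 and 1. *)
Lemma egamma_halfn n : (0 < egamma (n.+1%:R / 2) < +oo)%E.
Proof.
elim/ltn_ind: n => -[_|[_|n IH]].
- by rewrite mul1r egamma_half.
- by rewrite divff// egamma1 lte01 ltry.
have -> : n.+3%:R / 2 = n.+1%:R / 2 + 1 :> R.
  by rewrite -addn2 natrD mulrDl divff.
rewrite egammaS ?divr_gt0//.
have /andP[g0 goo] := IH n (leqnSn _).
by rewrite mule_gt0 ?lte_fin ?divr_gt0//= lte_mul_pinfty// lee_fin.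
Qed.

(* If the integral is infinite, [fine] makes both sides 0. *)
Lemma GammaS (s : R) : 0 < s -> Gamma (s + 1) = s * Gamma s.
Proof.
move=> s0; have := egammaS _ s0; rewrite /egamma /Gamma => ->.
set I := integral _ _ _; have := lt0r_neq0 s0; move: s0.
case: I => [r| |] s0 sn0 //; rewrite ?gt0_muley ?gt0_muleNy ?lte_fin//=.
- by rewrite mulr0.
- by rewrite mulr0.
Qed.

Lemma Gamma_half_gt0 n : 0 < Gamma (n.+1%:R / 2 : R).
Proof. by have := egamma_halfn n; exact: fine_gt0. Qed.

End gamma.

(** * Moment generating function of a rotation-invariant vector *)

Lemma cosh_eseries (R : realType) (x : R) :
  (\sum_(0 <= k <oo) (x ^+ k.*2 / (k.*2)`!%:R)%:E =
   ((expR x + expR (- x)) / 2)%:E)%E.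
Proof.
pose c N : R := \sum_(0 <= k < N) x ^+ k.*2 / (k.*2)`!%:R.
(* In the exponential series at [x] and [- x], cut after [2 * N] terms, the odd terms cancel and the
   even ones double. *)
have cE N : c N =
    (series (exp_coeff x) (2 * N)%N + series (exp_coeff (- x)) (2 * N)%N) / 2.
  rewrite /c /series/= mul2n; elim: N => [|N IH].
    by rewrite !big_nil addr0 mul0r.
  rewrite doubleS big_nat_recr//= IH !big_nat_recr//= /exp_coeff/=.
  have -> : (- x) ^+ N.*2 = x ^+ N.*2 by rewrite -mul2n !exprM sqrrN.
  have -> : (- x) ^+ N.*2.+1 = - x ^+ N.*2.+1.
    by rewrite !exprS -mul2n !exprM sqrrN mulNr.
  rewrite mulNr; set A := bigop.body _ _ _; set B := bigop.body _ _ _.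
  move: A B (x ^+ N.*2 / _) (x ^+ N.*2.+1 / _) => A B C D; lra.
suff : c N @[N --> \oo] --> (expR x + expR (- x)) / 2.
  move=> cl; apply/cvg_lim => //.
  rewrite (_ : (fun n => _) = EFin \o c); last first.
    by apply/funext => N; rewrite /= sumEFin.
  by apply: cvg_EFin cl; exact: nearW.
rewrite (_ : c = fun N => (series (exp_coeff x) (2 * N)%N +
    series (exp_coeff (- x)) (2 * N)%N) / 2); last exact/funext.
apply: cvgMl; apply: cvgD.
  apply: (@cvg_comp _ _ _ (fun N => (2 * N)%N) (series (exp_coeff x)) _ \oo).
    exact: cvg_mulnl.
  exact: is_cvg_series_exp_coeff.
apply: (@cvg_comp _ _ _ (fun N => (2 * N)%N) (series (exp_coeff (- x))) _ \oo).
  exact: cvg_mulnl.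
exact: is_cvg_series_exp_coeff.
Qed.

Section rotation_invariant_mgf.
Context {R : realType} {dT : measure_display} {T : measurableType dT}.
Variables (P : probability T R) (d : nat) (u : T -> 'rV[R]_d.+1).
Hypothesis mu : forall k, measurable_fun setT (fun t => u t 0 k).
Hypothesis rotu : rot_invariant P u.
Hypothesis mom : forall n,
  P.-integrable setT (fun t => (dotv (u t) (u t) ^+ n)%:E).

Let ms : measurable_fun setT (fun t => dotv (u t) (u t)).
Proof. exact: measurable_dotv. Qed.

Let M j k := \int[P]_t (dotv (u t) (u t) ^+ j * u t 0 0 ^+ k.*2).
Let h : R := d.+1%:R / 2.

Let GammaDh k : 0 < Gamma (k%:R + h).
Proof.
rewrite /h -[k%:R](mulfK (_ : 2 != 0 :> R))//.
by rewrite -mulrDl -natrM -natrD addnS Gamma_half_gt0.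
Qed.

(** Induction on [k] for all [j] at once: [moment_recurrence] trades a factor [u_0^2] for [|u|^2],
    and since [2k+d+1 = 2(k+h)], the denominator it produces is absorbed by
    [Gamma (s + 1) = s * Gamma s] at [s = k + h]. *)
Lemma even_moment j k :
  M j k = (k.*2)`!%:R * Gamma h / (2 ^+ (2 * k) * k`!%:R * Gamma (k%:R + h))
          * M (j + k)%N 0%N.
Proof.
elim: k j => [|k IH] j.
  have G0 : Gamma h != 0 by have := lt0r_neq0 (GammaDh 0%N); rewrite add0r.
  by rewrite muln0 expr0 fact0 add0r addn0 !mul1r divff// mul1r.
have D0 : (k.*2 + d.+1)%:R != 0 :> R by rewrite pnatr_eq0 addnS.
apply: (mulfI D0).
rewrite -(moment_recurrence _ _ _ mu rotu mom) -/(M _ _) IH addSnnS.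
have -> : k.+1%:R + h = k%:R + h + 1 by rewrite -natr1; ring.
have kh : 0 < k%:R + h by rewrite ltr_wpDl// divr_gt0.
rewrite GammaS// doubleS !factS !natrM mulnS exprD.
have -> : (k.*2 + d.+1)%:R = 2 * (k%:R + h) :> R.
  by rewrite natrD -muln2 natrM /h; field.
have k0 : k`!%:R != 0 :> R by rewrite pnatr_eq0 -lt0n fact_gt0.
have kk0 : (k.*2)`!%:R != 0 :> R by rewrite pnatr_eq0 -lt0n fact_gt0.
have -> : k.*2.+2%:R = 2 * k.+1%:R :> R by rewrite -doubleS -mul2n natrM.
have G0 := lt0r_neq0 (GammaDh k); have kh0 := lt0r_neq0 kh.
have k10 : k.+1%:R != 0 :> R by rewrite pnatr_eq0.
have e0 : 2 ^+ (2 * k) != 0 :> R by rewrite expf_neq0.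
move: (Gamma h) (Gamma (k%:R + h)) G0 => g g' g'0.
move: (k%:R + h) kh0 => s s0.
move: (k`!%:R) k0 (k.*2)`!%:R kk0 (2 ^+ (2 * k)) e0 (k.+1%:R) k10.
move=> f f0 f2 f20 e e0 k1 k10; move: (M _ _) (k.*2.+1%:R) => M' k21.
by field; rewrite g'0 s0 f0 k10 e0.
Qed.

Lemma rotation_invariant_mgf (z : 'rV[R]_d.+1) :
  (\int[P]_t (expR (dotv (u t) z))%:E = (Gamma h)%:E *
   \int[P]_t (\sum_(0 <= k <oo)
     (norm2 z ^+ (2 * k) * norm2 (u t) ^+ (2 * k)
      / (2 ^+ (2 * k) * k`!%:R * Gamma (k%:R + h)))%:E))%E.
Proof.
have mz (a : 'rV[R]_d.+1) : measurable_fun setT (fun t => dotv (u t) a).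
  exact: measurable_dotv.
have nN (a : 'rV[R]_d.+1) : norm2 (- a) = norm2 a.
  by congr Num.sqrt; apply: eq_bigr => k _; rewrite mxE sqrrN.
have dN t : dotv (u t) (- z) = - dotv (u t) z.
  by rewrite dotvC -scaleN1r dotvZl mulN1r dotvC.
(* The vectors [z] and [- z] have equal norm, so the integral may be symmetrised. The cosh series
   has only nonnegative terms, so it can be exchanged with the integral without any domination. *)
have -> : (\int[P]_t (expR (dotv (u t) z))%:E =
    \int[P]_t ((expR (dotv (u t) z) + expR (- dotv (u t) z)) / 2)%:E)%E.
  have mh : measurable_fun setT (fun p : R * R => expR p.2).
    by apply: measurableT_comp.
  have H := rot_invariant_integral P _ u mu rotu _ _ (fun p => expR p.2)
    (nN z) mh (fun p _ => expR_ge0 _).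
  rewrite /= in H; under [RHS]eq_integral do rewrite mulrC EFinM EFinD.
  have m1 : measurable_fun setT (fun t => (expR (dotv (u t) z))%:E).
    by apply/measurable_EFinP; exact: measurableT_comp.
  have m2 : measurable_fun setT (fun t => (expR (- dotv (u t) z))%:E).
    by apply/measurable_EFinP; do 2 apply: measurableT_comp => //.
  rewrite ge0_integralZl_EFin//; last 2 first.
  - by move=> t _; rewrite adde_ge0// lee_fin expR_ge0.
  - exact: emeasurable_funD.
  rewrite ge0_integralD//.
  under [X in (_ * (_ + X))%E]eq_integral do rewrite -dN.
  (* Half of [I + I] is [I] also for an infinite [I], hence the case analysis. *)
  rewrite H; set I := integral _ _ _; have : (0 <= I)%E.
    by apply: integral_ge0 => t _; rewrite lee_fin expR_ge0.
  case: I => [r _| |]//=; first by rewrite -EFinD -EFinM; congr (_%:E); field.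
  by rewrite gt0_muley ?lte_fin.
under eq_integral do rewrite -cosh_eseries.
rewrite integral_nneseries//; last 2 first.
- move=> n; apply/measurable_EFinP/measurable_funM => //.
  exact: measurable_funX.
- by move=> n t _; rewrite lee_fin divr_ge0// -mul2n exprM exprn_ge0// sqr_ge0.
have cge0 k : 0 <= (2 ^+ (2 * k) * k`!%:R * Gamma (k%:R + h))^-1.
  by rewrite invr_ge0 !mulr_ge0 ?exprn_ge0// ltW.
rewrite integral_nneseries//; last 2 first.
- move=> n; apply/measurable_EFinP/measurable_funM => //.
  apply: measurable_funM => //.
  apply: (eq_measurable_fun (fun t => dotv (u t) (u t) ^+ n)).
    by move=> t _; rewrite exprM norm2_sqr.
  exact: measurable_funX.
- by move=> n t _; rewrite lee_fin mulr_ge0// mulr_ge0// exprn_ge0// norm2_ge0.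
rewrite -nneseriesZl; last first.
  move=> k _; apply: integral_ge0 => t _.
  by rewrite lee_fin mulr_ge0// mulr_ge0// exprn_ge0// norm2_ge0.
apply: eq_eseriesr => k _.
have int_u0 : P.-integrable setT (fun t => (u t 0 0 ^+ k.*2)%:E).
  apply: eq_integrable (integrable_monomial _ _ _ mu mom 0 k 0 0 isT) => //.
  by move=> t _; rewrite /= expr0 mul1r subn0 mulr1.
have -> : (\int[P]_t (norm2 z ^+ (2 * k) * norm2 (u t) ^+ (2 * k)
      / (2 ^+ (2 * k) * k`!%:R * Gamma (k%:R + h)))%:E =
    (norm2 z ^+ (2 * k) / (2 ^+ (2 * k) * k`!%:R * Gamma (k%:R + h)) *
     M k 0)%:E)%E.
  rewrite EFinM /M /Rintegral fineK; last first.
    apply: integrable_fin_num => //; apply: eq_integrable (mom k) => //.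
    by move=> t _; rewrite /= expr0 mulr1.
  rewrite -integralZl//; last first.
    apply: eq_integrable (mom k) => //.
    by move=> t _; rewrite /= expr0 mulr1.
  apply: eq_integral => t _; rewrite -EFinM expr0 mulr1; congr (_%:E).
  by rewrite [norm2 (u t) ^+ _]exprM norm2_sqr mulrAC.
have -> : (\int[P]_t (dotv (u t) z ^+ k.*2 / (k.*2)`!%:R)%:E =
    (norm2 z ^+ (2 * k) / (k.*2)`!%:R * M 0 k)%:E)%E.
  (* Rotating [z] onto the first axis turns the moment of [u.z] into [|z|^(2k)] times that of
     [u_0]. *)
  have nz : norm2 z = norm2 (norm2 z *: delta_mx 0 0 : 'rV[R]_d.+1).
    rewrite [RHS]norm2E dotvZl dotvC dotv_delta mxE mxE !eqxx mulr1 -expr2.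
    by rewrite sqrtr_sqr ger0_norm ?norm2_ge0.
  have mh : measurable_fun setT (fun p : R * R => p.2 ^+ k.*2 / (k.*2)`!%:R).
    by apply: measurable_funM => //; exact: measurable_funX.
  have h0 (p : R * R) : 0 <= p.1 -> 0 <= p.2 ^+ k.*2 / (k.*2)`!%:R.
    by move=> _; rewrite divr_ge0// -mul2n exprM exprn_ge0// sqr_ge0.
  have /= -> := rot_invariant_integral P _ u mu rotu _ _ _ nz mh h0.
  rewrite EFinM /M /Rintegral fineK; last first.
    apply: integrable_fin_num => //; apply: eq_integrable int_u0 => //.
    by move=> t _; rewrite /= expr0 mul1r.
  rewrite -integralZl//; last first.
    apply: eq_integrable int_u0 => //.
    by move=> t _; rewrite /= expr0 mul1r.
  apply: eq_integral => t _; rewrite -EFinM expr0 mul1r; congr (_%:E).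
  by rewrite dotvC dotvZl dotvC dotv_delta exprMn mul2n mulrAC.
rewrite -EFinM; congr (_%:E); rewrite even_moment add0n.
have kk0 : (k.*2)`!%:R != 0 :> R by rewrite pnatr_eq0 -lt0n fact_gt0.
move: (M k 0) (2 ^+ (2 * k) * _ * _)^-1 (Gamma h) (norm2 z ^+ _) => M' c g v.
move: (k.*2)`!%:R kk0 => f f0.
by field; rewrite f0.
Qed.

End rotation_invariant_mgf.

(** * Integrability from exponential moments *)

Lemma expr_even_le_cosh (R : realType) (x : R) n :
  x ^+ n.*2 <= (n.*2)`!%:R * (expR x + expR (- x)).
Proof.
have f0 : 0 < (n.*2)`!%:R :> R by rewrite ltr0n fact_gt0.
rewrite -ler_pdivrMl//.
have c0 k : (0 <= (x ^+ k.*2 / (k.*2)`!%:R)%:E)%E.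
  by rewrite lee_fin divr_ge0// -mul2n exprM exprn_ge0// sqr_ge0.
(* The term of index [n] is below the partial sum that ends with it, hence below the cosh series;
   the factor 1/2 is given away afterwards. *)
have := @nneseries_lim_ge R (fun k => (x ^+ k.*2 / (k.*2)`!%:R)%:E)
  xpredT 0%N n.+1 (fun k _ _ => c0 k).
rewrite cosh_eseries big_nat_recr//= sumEFin -EFinD lee_fin mulrC => H.
rewrite (@le_trans _ _ ((expR x + expR (- x)) / 2))//.
  apply: le_trans H; rewrite lerDr sumr_ge0// => k _.
  by have := c0 k; rewrite lee_fin.
by rewrite ler_pdivrMr// ler_peMr ?addr_ge0 ?expR_ge0// ler1n.
Qed.

(** The squared norm is at most [d.+1] times the largest squared coordinate, and the [n]-th power of
    the latter is one term of the sum. *)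
Lemma dotvv_exp_le (R : realType) d (v : 'rV[R]_d.+1) n :
  dotv v v ^+ n <= d.+1%:R ^+ n * \sum_(k < d.+1) v 0 k ^+ n.*2.
Proof.
have [k _ kmax] := @Order.TotalTheory.arg_maxP _ _ _ (ord0 : 'I_d.+1) xpredT
  (fun k => v 0 k ^+ 2) isT.
have vk : dotv v v <= d.+1%:R * v 0 k ^+ 2.
  have -> : d.+1%:R * v 0 k ^+ 2 = \sum_(l < d.+1) v 0 k ^+ 2.
    by rewrite sumr_const card_ord mulr_natl.
  by apply: ler_sum => l _; rewrite -expr2; exact: kmax.
have sq0 l : 0 <= v 0 l ^+ n.*2 by rewrite -mul2n exprM exprn_ge0// sqr_ge0.
apply: (@le_trans _ _ (d.+1%:R ^+ n * v 0 k ^+ n.*2)).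
  rewrite -mul2n exprM -exprMn lerXn2r ?nnegrE ?dotvv_ge0//.
  by rewrite mulr_ge0 ?sqr_ge0.
by rewrite ler_wpM2l ?exprn_ge0// (bigD1 k)//= lerDl sumr_ge0.
Qed.

Section integrable_exponential_moments.
Context {R : realType} {dT : measure_display} {T : measurableType dT}.
Variable P : probability T R.

(** The power is dominated by a combination of exponentials of [u] along the positive and negative
    coordinate axes. This supplies the hypothesis [mom]. *)
Lemma integrable_dotv_pow d (u : T -> 'rV[R]_d.+1) n :
  (forall k, measurable_fun setT (fun t => u t 0 k)) ->
  (forall z, P.-integrable setT (fun t => (expR (dotv (u t) z))%:E)) ->
  P.-integrable setT (fun t => (dotv (u t) (u t) ^+ n)%:E).
Proof.
move=> mu expu.
pose c : R := d.+1%:R ^+ n * (n.*2)`!%:R.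
pose g t := (\sum_(k < d.+1)
  c%:E * ((expR (u t 0%R k))%:E + (expR (- u t 0%R k))%:E))%E.
have gint : P.-integrable setT g.
  apply: integrable_sum => // k _; apply: integrableZl => //.
  apply: integrableD => //.
    apply: eq_integrable (expu (delta_mx 0 k)) => // t _.
    by rewrite dotv_delta.
  apply: eq_integrable (expu (- delta_mx 0 k)) => // t _.
  by rewrite dotvC -scaleN1r dotvZl dotvC dotv_delta mulN1r.
apply: le_integrable gint => //.
  apply/measurable_EFinP/measurable_funX; exact: measurable_dotv.
move=> t _; rewrite /g.
under eq_bigr do rewrite -EFinD -EFinM.
rewrite sumEFin !abse_EFin lee_fin ger0_norm ?exprn_ge0 ?dotvv_ge0//.
apply: le_trans (ler_norm _); apply: le_trans (dotvv_exp_le _ _ _ _) _.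
rewrite mulr_sumr ler_sum// => k _; rewrite /c -mulrA ler_wpM2l ?exprn_ge0//.
exact: expr_even_le_cosh.
Qed.

Lemma gaussian_integrable d (X : T -> 'rV[R]_d) (z : 'rV[R]_d) :
  (forall k, measurable_fun setT (fun t => X t 0 k)) ->
  std_gaussian_vec P X ->
  P.-integrable setT (fun t => (expR (dotv (X t) z))%:E).
Proof.
move=> mX gX; apply/integrableP; split.
  apply/measurable_EFinP; apply: measurableT_comp => //.
  exact: measurable_dotv.
under eq_integral do rewrite abse_EFin ger0_norm ?expR_ge0//.
by rewrite gaussian_mgf// ltry.
Qed.

(** [X] and [Y] may be dependent, so the exponential of the sum is bounded by marginal quantities:
    [p * q <= p ^+ 2 + q ^+ 2], where the squares are the exponentials at [2 *: z]. *)
Lemma integrable_expR_dotvD d (X Y : T -> 'rV[R]_d) (z : 'rV[R]_d) :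
  (forall k, measurable_fun setT (fun t => X t 0 k)) ->
  (forall k, measurable_fun setT (fun t => Y t 0 k)) ->
  P.-integrable setT (fun t => (expR (dotv (X t) (2 *: z)))%:E) ->
  P.-integrable setT (fun t => (expR (dotv (Y t) (2 *: z)))%:E) ->
  P.-integrable setT (fun t => (expR (dotv (X t + Y t) z))%:E).
Proof.
move=> mX mY iX iY; apply: le_integrable (integrableD measurableT iX iY) => //.
  apply/measurable_EFinP; apply: measurableT_comp => //.
  apply: measurable_dotv => // k; under eq_fun do rewrite mxE.
  exact: measurable_funD.
move=> t _; rewrite -EFinD !abse_EFin lee_fin.
rewrite ger0_norm ?expR_ge0// ger0_norm ?addr_ge0 ?expR_ge0//.
rewrite !(dotvC _ _ (2 *: z)) !dotvZl !(dotvC _ z) dotvDl expRD.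
rewrite !mulr_natl !mulr2n !expRD.
move: (expR _) (expR _) (expR_ge0 (dotv (X t) z)) (expR_ge0 (dotv (Y t) z)).
move=> p q p0 q0.
nra.
Qed.

End integrable_exponential_moments.

(** * The estimator and its mean squared error *)

Section estimator.
Context {R : realType} {dT : measure_display} {T : measurableType dT}.

(** The parallelogram law; it extracts the prefactor that the estimator also has. *)
Lemma gaussKE d (x y : 'rV[R]_d) :
  gaussK x y =
  expR (- norm2 x ^+ 2 - norm2 y ^+ 2) * expR (norm2 (x + y) ^+ 2 / 2).
Proof.
rewrite /gaussK -expRD; congr expR; rewrite !norm2_sqr.
rewrite dotvBl dotvDl !(dotvC _ _ (x - y)) !(dotvC _ _ (x + y)).
by rewrite !dotvBl !dotvDl (dotvC _ y x); field.
Qed.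

Lemma KhatE d m (w : 'I_m -> T -> 'rV[R]_d) (x y : 'rV[R]_d) t :
  Khat w x y t = expR (- norm2 x ^+ 2 - norm2 y ^+ 2) / m%:R *
    \sum_(i < m) expR (dotv (w i t) (x + y)).
Proof.
rewrite /Khat {1}/dotv mulr_sumr; apply: eq_bigr => i _; rewrite !mxE.
have -> : (m%:R : R)^-1 = (Num.sqrt m%:R)^-1 * (Num.sqrt m%:R)^-1.
  by rewrite -invfM -expr2 sqr_sqrtr.
rewrite (dotvC _ _ (x + y)) dotvDl !expRD !(dotvC _ _ (w i t)).
move: (Num.sqrt _)^-1 => s; ring.
Qed.

End estimator.

Theorem theorem3p2 (R : realType) (dT : measure_display) (T : measurableType dT)
  (P : probability T R) (d m : nat) (w : 'I_m -> T -> 'rV[R]_d)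
  (x y : 'rV[R]_d) :
  (1 <= d)%N -> (2 <= m)%N ->
  (forall i (k : 'I_d), measurable_fun setT (fun t => w i t 0 k)) ->
  (forall i, std_gaussian_vec P (w i)) ->
  (forall i j, i != j -> rot_invariant P (fun t => w i t + w j t)) ->
  let xn := norm2 x in let yn := norm2 y in let v := norm2 (x + y) in
  ('E_P[fun t => ((Khat w x y t - gaussK x y) ^+ 2)%R])%E =
    ((expR (- 2 * xn ^+ 2 - 2 * yn ^+ 2) / m%:R)%:E *
     ((expR (2 * v ^+ 2) - expR (v ^+ 2))%:E
      + (m%:R - 1)%:E * (rf_conformity P w x y - (expR (v ^+ 2))%:E)))%E.
Proof.
(* Writing the dimension as a successor provides the coordinate 0 used for moments. *)
case: d w x y => // d w x y _ m2 mw gw rw xn yn v.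
set z := x + y.
have iw i a : P.-integrable setT (fun t => (expR (dotv (w i t) a))%:E).
  exact: gaussian_integrable.
have iww i j a :
    P.-integrable setT (fun t => (expR (dotv (w i t + w j t) a))%:E).
  exact: integrable_expR_dotvD.
have mww i j k : measurable_fun setT (fun t => (w i t + w j t) 0 k).
  by under eq_fun do rewrite mxE; exact: measurable_funD.
pose A i j := \int[P]_t expR (dotv (w i t + w j t) z).
have AE i j : (\int[P]_t (expR (dotv (w i t + w j t) z))%:E)%E = (A i j)%:E.
  by rewrite /A /Rintegral fineK//; exact: integrable_fin_num.
(* On the diagonal the sum is [2 w_i], so the Gaussian formula applies at [2 *: z]. *)
have Aii i : A i i = expR (2 * v ^+ 2).
  rewrite /A /Rintegral.
  have -> : (fun t => (expR (dotv (w i t + w i t) z))%:E) =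
            (fun t => (expR (dotv (w i t) (2 *: z)))%:E).
    apply/funext => t; rewrite dotvDl (dotvC _ _ (2 *: z)) dotvZl dotvC.
    by rewrite mulr_natl mulr2n.
  rewrite gaussian_mgf// norm2_sqr dotvZl dotvC dotvZl -norm2_sqr /=.
  by congr expR; rewrite -/v; field.
have Bi i : \int[P]_t expR (dotv (w i t) z) = expR (v ^+ 2 / 2).
  by rewrite /Rintegral gaussian_mgf.
pose S := \sum_(i < m) \sum_(j < m | j != i) A i j.
have g0 : Gamma (d.+1%:R / 2 : R) != 0 by rewrite gt_eqF// Gamma_half_gt0.
have m0 : m%:R != 0 :> R by rewrite pnatr_eq0 -lt0n ltnW.
have m1 : m%:R - 1 != 0 :> R.
  by rewrite subr_eq0 (eqr_nat _ m 1) gtn_eqF.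
(* The RF-conformity is the average of the off-diagonal [A i j]. In particular it is finite, and the
   final identity can be checked in [R]. *)
have rhoE : rf_conformity P w x y = (S / (m%:R * (m%:R - 1)))%:E.
  rewrite /rf_conformity -/z.
  have rho_ij i j : j != i -> (\int[P]_t (\sum_(0 <= k <oo)
        ((norm2 z ^+ (2 * k) * (norm2 (w i t + w j t)) ^+ (2 * k)
          / (2 ^+ (2 * k) * k`!%:R * Gamma (k%:R + d.+1%:R / 2)))%:E)) =
        (A i j / Gamma (d.+1%:R / 2))%:E)%E.
    move=> ji; have ruv : rot_invariant P (fun t => w i t + w j t).
      by apply: rw; rewrite eq_sym.
    have := rotation_invariant_mgf P d _ (mww i j) ruv
      (fun n => integrable_dotv_pow P d _ n (mww i j) (iww i j)) z.
    rewrite AE => AijE.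
    by rewrite [RHS]EFinM AijE muleC muleA -EFinM mulVf// mul1e.
  under eq_bigr do under eq_bigr => j ji do rewrite rho_ij//.
  under eq_bigr do rewrite sumEFin.
  rewrite sumEFin -EFinM; congr (_%:E).
  under eq_bigr do rewrite -mulr_suml.
  by rewrite -mulr_suml -/S; field; rewrite g0 m0 m1.
pose e := expR (- xn ^+ 2 - yn ^+ 2); pose kk := expR (v ^+ 2 / 2).
pose E i t := expR (dotv (w i t) z).
(* The random part of the expanded square: the square of the sum of the [E i t], minus
   [2 * m%:R * kk] times that sum. The constant [(m%:R * kk) ^+ 2] is kept apart. *)
pose G t := \sum_(i < m) (\sum_(j < m) expR (dotv (w i t + w j t) z) +
  (- (2 * m%:R * kk)) * E i t).
have sqE t : (Khat w x y t - gaussK x y) ^+ 2 =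
    (e / m%:R) ^+ 2 * (G t + (m%:R * kk) ^+ 2).
  rewrite KhatE gaussKE -/xn -/yn -/e -/z -/v -/kk.
  have -> : G t = (\sum_(i < m) E i t) ^+ 2 -
      2 * m%:R * kk * \sum_(i < m) E i t.
    rewrite /G big_split/= -mulr_sumr mulNr; congr (_ - _).
    rewrite expr2 mulr_suml; apply: eq_bigr => i _; rewrite mulr_sumr.
    by apply: eq_bigr => j _; rewrite dotvDl expRD.
  rewrite -/(E _ t); move: (\sum_(i < m) E i t) => s.
  by field.
have iE (I : Type) (r : seq I) (f : I -> T -> R) :
    (forall i, P.-integrable setT (EFin \o f i)) ->
    P.-integrable setT (EFin \o (fun t => \sum_(i <- r) f i t)).
  move=> fi; rewrite (_ : EFin \o _ = (fun t => \sum_(i <- r) (f i t)%:E)%E).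
    by apply: integrable_sum => // i _; exact: fi.
  by apply/funext => t; rewrite /= sumEFin.
have iGi i : P.-integrable setT (EFin \o (fun t =>
    \sum_(j < m) expR (dotv (w i t + w j t) z) + (- (2 * m%:R * kk)) * E i t)).
  have H1 := iE _ (index_enum 'I_m)
    (fun j t => expR (dotv (w i t + w j t) z)) (fun j => iww i j z).
  have H2 := integrableZl measurableT (- (2 * m%:R * kk)) (iw i z).
  exact: eq_integrable (integrableD measurableT H1 H2).
have iG : P.-integrable setT (EFin \o G) by exact: iE.
(* The [m] diagonal terms give [expR (2 * v ^+ 2)] each, the off-diagonal ones [S], and the cross
   term has mean [2 * m%:R * kk] times [m%:R * kk]. *)
have GE :
    \int[P]_t G t = m%:R * expR (2 * v ^+ 2) + S - 2 * m%:R ^+ 2 * kk ^+ 2.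
  rewrite Rintegral_sum//.
  have -> : \sum_(i < m) \int[P]_t (\sum_(j < m) expR (dotv (w i t + w j t) z) +
      (- (2 * m%:R * kk)) * E i t) =
      \sum_(i < m) (expR (2 * v ^+ 2) + \sum_(j < m | j != i) A i j -
        2 * m%:R * kk ^+ 2).
    apply: eq_bigr => i _; rewrite RintegralD//; last 2 first.
    - by apply: iE => j; exact: iww.
    - exact: (integrableZl measurableT (- (2 * m%:R * kk)) (iw i z)).
    rewrite RintegralZl// ?Bi; last exact: iw.
    rewrite Rintegral_sum//; last by move=> j; exact: iww.
    by rewrite (bigD1 i)//= -/(A i i) Aii -/kk; congr (_ + _); ring.
  rewrite big_split big_split/= !sumr_const card_ord -/S.
  rewrite -[expR _ *+ m]mulr_natl -[(- _) *+ m]mulr_natl.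
  by congr (_ + _); ring.
have iF : P.-integrable setT (EFin \o (fun t => G t + (m%:R * kk) ^+ 2)).
  have H := finite_measure_integrable_cst P ((m%:R * kk) ^+ 2) measurableT.
  exact: eq_integrable (integrableD measurableT iG H).
have -> : ('E_P[fun t => ((Khat w x y t - gaussK x y) ^+ 2)%R])%E =
    ((e / m%:R) ^+ 2 * (\int[P]_t G t + (m%:R * kk) ^+ 2))%:E.
  rewrite unlock; under eq_integral do rewrite /= sqE EFinM.
  rewrite integralZl// [RHS]EFinM; congr (_ * _)%E.
  rewrite -(fineK (integrable_fin_num measurableT iF)); congr (_%:E).
  rewrite -[LHS]/(\int[P]_t (G t + (m%:R * kk) ^+ 2)) RintegralD//; last first.
    exact: finite_measure_integrable_cst.
  by rewrite Rintegral_cst//= probability_setT mulr1.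
(* The constants leave [- m^2 kk^2]; after division by [m] it splits into [- kk^2] for the first
   bracket and [- (m-1) kk^2] for the second. *)
rewrite GE rhoE -!EFinB -EFinM; congr (_%:E).
have -> : expR (- 2 * xn ^+ 2 - 2 * yn ^+ 2) = e ^+ 2.
  by rewrite /e -expRM_natl; congr expR; ring.
have -> : expR (v ^+ 2) = kk ^+ 2.
  by rewrite /kk -expRM_natl; congr expR; field.
by field; rewrite m0 m1.
Qed.
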